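(* Let $P\subseteq\mathcal{S}$ be a nonempty set of scenarios, and let $p^P=\sum_{s\in P}p^s$, $h^P=\frac{\sum_{s\in P}p^s h^s}{\sum_{s\in P}p^s}$ and $T^P=\frac{\sum_{s\in P}p^s T^s}{\sum_{s\in P}p^s}$. Then the inequalities $$p^P\cdot(h^P-T^Px)^\intercal\hat\lambda^P\le\sum_{s\in P}p^s\theta^s,\qquad \hat\lambda^P\in\mathrm{XP}(\Lambda),$$ are valid for the multi-cuts Benders reformulation $$\min_{x\in\mathcal{X},\,\theta\in\mathbb{R}^{|\mathcal{S}|}}\ c^\intercal x+\sum_{s\in\mathcal{S}}p^s\theta^s$$ subject to $$(h^s-T^sx)^\intercal\hat\lambda\le\theta^s\quad\text{for all }\hat\lambda\in\mathrm{XP}(\Lambda),\ s\in\mathcal{S},\qquad (h^s-T^sx)^\intercal\tilde\lambda\le 0\quad\text{for all }\tilde\lambda\in\mathrm{XR}(\Lambda),\ s\in\mathcal{S};$$ that is, every feasible point $(x,\theta)$ of this reformulation satisfies them.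
   Context: Setting: a two-stage linear stochastic program with fixed recourse, $\min_{x\in\mathcal{X}}c^\intercal x+\sum_{s\in\mathcal{S}}p^sQ(x,\xi^s)$, where $c\in\mathbb{R}^n$, $\mathcal{X}\subseteq\mathbb{R}^n$ is a nonempty closed (polyhedral, possibly with integrality restrictions on some variables) set, $\mathcal{S}$ is a finite set of scenarios with probabilities $p^s>0$ (summing to 1), $\xi^s=(T^s,h^s)$ with $T^s\in\mathbb{R}^{p\times n}$, $h^s\in\mathbb{R}^p$, and $Q(x,\xi^s)=\min\{q^\intercal y: Wy=h^s-T^sx,\ y\ge 0\}$ with fixed $W\in\mathbb{R}^{p\times m}$ and $q\in\mathbb{R}^m$. It is assumed that there is some $\bar x$ such that $Q(\bar x,\xi^s)$ is feasible and bounded for all $s\in\mathcal{S}$. The LP dual of the subproblem is $\max\{(h^s-T^sx)^\intercal\lambda:\lambda\in\Lambda\}$ with $\Lambda=\{\lambda\in\mathbb{R}^p: W^\intercal\lambda\le q\}$. $\mathrm{XP}(\Lambda)$ and $\mathrm{XR}(\Lambda)$ denote the sets of extreme points and extreme rays of $\Lambda$. *)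

(* Defs.v *)
From HB Require Import structures.
From mathcomp Require Import all_boot all_order all_algebra.
From mathcomp Require Import all_classical all_reals all_analysis.

Set Implicit Arguments.
Unset Strict Implicit.
Unset Printing Implicit Defensive.

Import Order.TTheory GRing.Theory Num.Theory.
Import numFieldNormedType.Exports.

Local Open Scope classical_set_scope.
Local Open Scope ring_scope.

Definition dotv (R : realType) (k : nat) (u v : 'cV[R]_k) : R :=
  (u^T *m v) 0 0.

(* Componentwise order; unrelated to the row-space inclusion (_ <= _)%MS. *)
Definition vle (R : realType) (k : nat) (u v : 'cV[R]_k) : Prop :=
  forall i, u i 0 <= v i 0.

Record program (R : realType) (T : Type) := Program {
  objective : T -> R;
  feasible_set : set T
}.

Definition feasible (R : realType) (T : Type) (M : program R T) : Prop :=
  feasible_set M !=set0.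

(* Programs are minimization problems, so boundedness means from below. *)
Definition bounded_program (R : realType) (T : Type) (M : program R T) : Prop :=
  has_lbound (objective M @` feasible_set M).

Definition valid_inequality (R : realType) (T : Type) (M : program R T)
    (lhs rhs : T -> R) : Prop :=
  forall z, feasible_set M z -> lhs z <= rhs z.

(* I indexes the integer-constrained coordinates; I empty gives a polyhedron. *)
Definition mixed_integer_polyhedral (R : realType) (n : nat)
    (X : set 'cV[R]_n) : Prop :=
  exists (k : nat) (A : 'M[R]_(k, n)) (b : 'cV[R]_k) (I : {set 'I_n}),
    X = [set x | vle (A *m x) b /\
                 forall i, i \in I -> x i 0 \is a Num.int].

Definition extreme_point (R : realType) (k : nat) (C : set 'cV[R]_k)
    : set 'cV[R]_k :=
  [set l | C l /\
    forall (u v : 'cV[R]_k) (t : R), C u -> C v -> 0 < t -> t < 1 ->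
      l = t *: u + (1 - t) *: v -> u = l /\ v = l].

Definition recession_cone (R : realType) (k : nat) (C : set 'cV[R]_k)
    : set 'cV[R]_k :=
  [set d | forall (l : 'cV[R]_k) (t : R), C l -> 0 <= t -> C (l + t *: d)].

(* An extreme ray is represented by all of its nonzero direction vectors. The
   multipliers a and b are nonnegative so that a line has no extreme ray. *)
Definition extreme_ray (R : realType) (k : nat) (C : set 'cV[R]_k)
    : set 'cV[R]_k :=
  [set d | [/\ recession_cone C d, d != 0 &
    forall u v : 'cV[R]_k, recession_cone C u -> recession_cone C v ->
      d = u + v ->
      (exists2 a : R, 0 <= a & u = a *: d) /\
      (exists2 b : R, 0 <= b & v = b *: d)]].

Definition recourse_program (R : realType) (n m k : nat)
    (W : 'M[R]_(k, m)) (q : 'cV[R]_m) (T : 'M[R]_(k, n)) (h : 'cV[R]_k)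
    (x : 'cV[R]_n) : program R 'cV[R]_m :=
  Program (fun y => dotv q y)
          [set y | W *m y = h - T *m x /\ vle 0 y].

Definition dual_polyhedron (R : realType) (m k : nat)
    (W : 'M[R]_(k, m)) (q : 'cV[R]_m) : set 'cV[R]_k :=
  [set l | vle (W^T *m l) q].

(* Decision variables are pairs (x, theta). *)
Definition multicut_benders (R : realType) (n m k : nat) (S : finType)
    (c : 'cV[R]_n) (X : set 'cV[R]_n) (p : S -> R)
    (T : S -> 'M[R]_(k, n)) (h : S -> 'cV[R]_k)
    (W : 'M[R]_(k, m)) (q : 'cV[R]_m) : program R ('cV[R]_n * (S -> R)) :=
  let L := dual_polyhedron W q in
  Program
    (fun z => dotv c z.1 + \sum_(s : S) p s * z.2 s)
    [set z | [/\ X z.1,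
      forall l s, extreme_point L l -> dotv (h s - T s *m z.1) l <= z.2 s &
      forall l s, extreme_ray L l -> dotv (h s - T s *m z.1) l <= 0]].

Definition agg_prob (R : realType) (S : finType) (p : S -> R) (P : {set S}) : R :=
  \sum_(s in P) p s.

(* Conditional mean of the matrix-valued data M over the scenarios in P. *)
Definition agg_data (R : realType) (a b : nat) (S : finType) (p : S -> R)
    (P : {set S}) (M : S -> 'M[R]_(a, b)) : 'M[R]_(a, b) :=
  (\sum_(s in P) p s)^-1 *: \sum_(s in P) p s *: M s.

(* Main.v *)
(* The aggregated left-hand side at an extreme point is the p-weighted sum over
   P of the left-hand sides of the single-scenario optimality cuts at that same
   point: the dual polyhedron does not depend on the scenario. *)

Require Import Defs.
From HB Require Import structures.
From mathcomp Require Import all_boot all_order all_algebra.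
From mathcomp Require Import all_classical all_reals all_analysis.
Import Order.TTheory GRing.Theory Num.Theory.
Import numFieldNormedType.Exports.
Local Open Scope classical_set_scope.
Local Open Scope ring_scope.

(** A member of [P] contributes a strictly positive term and the others cannot cancel it. So the
    inverse in [agg_data] is a true one, not the default [0^-1 = 0]. *)
Lemma agg_prob_gt0 (R : realType) (S : finType) (p : S -> R) (P : {set S}) :
  (forall s, 0 < p s) -> (exists s, s \in P) -> 0 < agg_prob p P.
Proof.
move=> p_gt0 [s sP]; rewrite /agg_prob (bigD1 s) //=.
by rewrite ltr_pwDl ?p_gt0 // sumr_ge0 // => i _; rewrite ltW.
Qed.

Lemma agg_prob_scale_agg_data (R : realType) (a b : nat) (S : finType)
    (p : S -> R) (P : {set S}) (M : S -> 'M[R]_(a, b)) :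
  agg_prob p P != 0 ->
  agg_prob p P *: agg_data p P M = \sum_(s in P) p s *: M s.
Proof. by move=> pP0; rewrite scalerA divff // scale1r. Qed.

Lemma dotvZl (R : realType) (k : nat) (a : R) (u v : 'cV[R]_k) :
  dotv (a *: u) v = a * dotv u v.
Proof. by rewrite /dotv linearZ /= -scalemxAl mxE. Qed.

Lemma dotv_suml (R : realType) (k : nat) (I : finType) (A : {set I})
    (u : I -> 'cV[R]_k) (v : 'cV[R]_k) :
  dotv (\sum_(i in A) u i) v = \sum_(i in A) dotv (u i) v.
Proof. by rewrite /dotv linear_sum /= mulmx_suml summxE. Qed.

(** For fixed [x] and [l] the cut is linear in the data [(h, T)], so weighting by [agg_prob p P]
    clears the denominators of both conditional means. *)
Lemma agg_cut_sum (R : realType) (n k : nat) (S : finType) (p : S -> R)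
    (P : {set S}) (T : S -> 'M[R]_(k, n)) (h : S -> 'cV[R]_k)
    (x : 'cV[R]_n) (l : 'cV[R]_k) :
  agg_prob p P != 0 ->
  agg_prob p P * dotv (agg_data p P h - agg_data p P T *m x) l =
  \sum_(s in P) p s * dotv (h s - T s *m x) l.
Proof.
(* The factor moves inside [dotv] and onto [h] and [T] separately, because the normalisation cancels
   only against each mean itself. *)
move=> pP0; rewrite -dotvZl scalerBr scalemxAl !agg_prob_scale_agg_data //.
rewrite mulmx_suml -sumrB dotv_suml; apply: eq_bigr => s _.
by rewrite -scalemxAl -scalerBr dotvZl.
Qed.

Theorem proposition2 (R : realType) (n m k : nat) (S : finType)
    (c : 'cV[R]_n) (X : set 'cV[R]_n) (p : S -> R)
    (T : S -> 'M[R]_(k, n)) (h : S -> 'cV[R]_k)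
    (W : 'M[R]_(k, m)) (q : 'cV[R]_m)
    (X_nonempty : X !=set0) (X_closed : closed X)
    (X_mip : mixed_integer_polyhedral X)
    (p_gt0 : forall s, 0 < p s) (p_sum1 : \sum_(s : S) p s = 1)
    (recourse_ok : exists xbar : 'cV[R]_n, forall s : S,
        feasible (recourse_program W q (T s) (h s) xbar) /\
        bounded_program (recourse_program W q (T s) (h s) xbar))
    (P : {set S}) (P_nonempty : exists s, s \in P) :
  forall lP : 'cV[R]_k, extreme_point (dual_polyhedron W q) lP ->
    valid_inequality (multicut_benders c X p T h W q)
      (fun z => agg_prob p P * dotv (agg_data p P h - agg_data p P T *m z.1) lP)
      (fun z => \sum_(s in P) p s * z.2 s).
Proof.
move=> lP lPx [x theta] [_ cuts _] /=.
rewrite agg_cut_sum ?gt_eqF ?agg_prob_gt0 //.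
(* Termwise, cancelling the weight [p s > 0] leaves the optimality cut of scenario [s] at [lP]. *)
by apply: ler_sum => s _; rewrite ler_pM2l //; exact: cuts.
Qed.
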